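(* Let $(X,K,\|\cdot\|)$ be a real ordered Banach space whose closed cone $K$ is normal and satisfies $\mathrm{int}(K)\neq\varnothing$. Let $A\in L(X)$ be a positive operator such that 1) some power of $A$ is strongly positive, i.e. for some $p\in\mathbb{N}$ one has $A^p(K\setminus\{0\})\subset \mathrm{int}(K)$; 2) some power of $A$ is a compact operator; 3) $\sup_{n\in\mathbb{N}}\|A^n\|<+\infty$. Then the sequence $\{A^n\}_{n\ge 0}$ converges pointwise (i.e. in norm at each $x\in X$) to some operator $A_0\in L(X)$. If $A_0$ is not zero, then there exist a vector $u\in\mathrm{int}(K)$ and a functional $f_0\in K'$ such that (i) $A(u)=u$, $A^*(f_0)=f_0$, $f_0(u)=1$, and moreover $f_0(x)>0$ if $x\in K$, $x\ne 0$; (ii) $A_0=f_0\otimes u$; (iii) for each $f\in X'$ one has $(A^* )^n(f)\to A_0^*(f)$ as $n\to+\infty$ with respect to the weak*-topology $\sigma(X',X)$; (iv) $\lambda=1$ is a simple eigenvalue of the operators $A$ and $A^*$. Moreover (whether or not $A_0$ is zero), (v) $\|A^n-A_0\|\to 0$ as $n\to\infty$, i.e. the operators $A^n$ (and also the adjoint operators $(A^n)^*$) converge to $A_0$ (respectively to $A_0^*$) with respect to the operator norm.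
   Context: A cone $K$ in a real vector space is a nonempty subset with $\lambda x+\mu y\in K$ for $x,y\in K$, $\lambda,\mu\ge 0$, and such that $x,-x\in K$ implies $x=0$. An ordered Banach space $(X,K,\|\cdot\|)$ is a real Banach space $X$ ordered by a closed cone $K$ ($x\le y$ iff $y-x\in K$). $K$ is normal if there is $\delta>0$ with $\|x+y\|\ge\delta\max\{\|x\|,\|y\|\}$ for all $x,y\in K$. $\mathrm{int}(K)$ is the norm interior of $K$. $X'$ is the dual of $X$ and $K'=\{f\in X': f(x)\ge 0 \text{ for all } x\in K\}$. $L(X)$ is the space of continuous linear operators on $X$; $A\in L(X)$ is positive if $A(K)\subset K$; $A^*$ is its adjoint on $X'$. ''Some power'' means $A^k$ for some $k\in\mathbb{N}=\{1,2,\dots\}$. For $f\in X'$, $u\in X$, $f\otimes u$ is the operator $x\mapsto f(x)u$. An eigenvalue is called simple if its eigenspace is one-dimensional. *)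

(* Defs.v *)
From HB Require Import structures.
From mathcomp Require Import all_boot all_order all_algebra.
From mathcomp Require Import all_classical all_reals all_analysis.

Set Implicit Arguments.
Unset Strict Implicit.
Unset Printing Implicit Defensive.

Import Order.TTheory GRing.Theory Num.Theory.
Import numFieldNormedType.Exports.

Local Open Scope classical_set_scope.
Local Open Scope ring_scope.

Section continuous_linear.
Variables (R : realType) (X Y : normedModType R).

Definition clin_pred : {pred X -> Y} :=
  mem [set f : X -> Y | linear f /\ continuous f].

Record clin := CLin { clin_fun :> X -> Y ; clinP : clin_fun \in clin_pred }.

HB.instance Definition _ := [isSub for clin_fun].
HB.instance Definition _ := [Choice of clin by <:].

Lemma clin_eqP (f g : clin) : f = g <-> f =1 g.
Proof. by split=> [->//|fg]; exact/val_inj/funext. Qed.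

Lemma clin_linear (f : clin) : linear f.
Proof. by have /set_mem[] := clinP f. Qed.

Lemma clin_continuous (f : clin) : continuous f.
Proof. by have /set_mem[] := clinP f. Qed.

HB.instance Definition _ (f : clin) :=
  GRing.isLinear.Build R X Y *:%R f (clin_linear f).

Definition mk_clin (f : X -> Y) (lf : linear f) (cf : continuous f) : clin :=
  CLin (mem_set (conj lf cf)).

Lemma clin_submod_closed : submod_closed clin_pred.
Proof.
split; first by apply/mem_set; split=> [a x y|];
  [rewrite scaler0 addr0 | exact: cst_continuous].
move=> a f g /set_mem[lf cf] /set_mem[lg cg]; apply/mem_set; split.
  move=> b x y; rewrite !fctE lf lg !scalerDr !scalerA (mulrC a b).
  by rewrite !addrA; congr (_ + _); rewrite -!addrA (addrC (a *: f y)).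
move=> x; apply: (@continuousD _ _ _ (a \*: f) g) => //; last exact: cg.
by apply: cvgZl_tmp; exact: cf.
Qed.

HB.instance Definition _ :=
  GRing.isSubmodClosed.Build _ _ clin_pred clin_submod_closed.
HB.instance Definition _ := [SubChoice_isSubLmodule of clin by <:].

Definition opnorm (f : clin) : R :=
  sup [set `|f x| | x in [set x | `|x| <= 1]].

Lemma opnorm_has_sup (f : clin) :
  has_sup [set `|f x| | x in [set x | `|x| <= 1]].
Proof.
split; first by exists `|f 0|, 0 => //=; rewrite normr0 ler01.
have /linear_bounded_continuous/bounded_funP/(_ 1)[M fM] := @clin_continuous f.
by exists M => _ [x /= x1 <-]; exact: fM.
Qed.

Lemma opnorm_ge0 (f : clin) : 0 <= opnorm f.
Proof.
apply: (@le_trans _ _ `|f 0|) => //.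
apply: ub_le_sup; first by case: (opnorm_has_sup f).
by exists 0 => //=; rewrite normr0 ler01.
Qed.

Lemma le_opnorm (f : clin) (x : X) : `|f x| <= opnorm f * `|x|.
Proof.
have [->|x0] := eqVneq x 0; first by rewrite linear0 !normr0 mulr0.
have nx : 0 < `|x| by rewrite normr_gt0.
rewrite -ler_pdivrMr// mulrC -[X in X * _]gtr0_norm ?invr_gt0// -normrZ.
rewrite -linearZ/=; apply: ub_le_sup; first by case: (opnorm_has_sup f).
by exists (`|x|^-1 *: x) => //=; rewrite normrZ normfV normr_id mulVf ?gt_eqF.
Qed.

Lemma opnorm_le (f : clin) (M : R) :
  0 <= M -> (forall x, `|f x| <= M * `|x|) -> opnorm f <= M.
Proof.
move=> M0 fM; apply: ge_sup; first by case: (opnorm_has_sup f).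
move=> _ [x /= x1 <-]; apply: (le_trans (fM x)).
by rewrite -[leRHS]mulr1 ler_wpM2l.
Qed.

Let opnormD (f g : clin) : opnorm (f + g) <= opnorm f + opnorm g.
Proof.
apply: opnorm_le => [|x]; first by rewrite addr_ge0 ?opnorm_ge0.
rewrite mulrDl; apply: (le_trans (ler_normD _ _)).
by rewrite lerD// le_opnorm.
Qed.

Let opnormZ_le (a : R) (f : clin) : opnorm (a *: f) <= `|a| * opnorm f.
Proof.
apply: opnorm_le => [|x]; first by rewrite mulr_ge0 ?opnorm_ge0.
rewrite -[leLHS]/(`|a *: f x|) normrZ -mulrA.
by rewrite ler_wpM2l// le_opnorm.
Qed.

Let opnormZ (a : R) (f : clin) : opnorm (a *: f) = `|a| * opnorm f.
Proof.
apply/eqP; rewrite eq_le opnormZ_le/=.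
have [->|a0] := eqVneq a 0; first by rewrite normr0 mul0r opnorm_ge0.
rewrite -ler_pdivlMl ?normr_gt0// -normfV.
by apply: le_trans (opnormZ_le _ _); rewrite scalerA mulVf// scale1r.
Qed.

Let opnorm0_eq0 (f : clin) : opnorm f = 0 -> f = 0.
Proof.
move=> f0; apply/clin_eqP => x; apply/eqP.
by rewrite -normr_le0 (le_trans (le_opnorm f x))// f0 mul0r.
Qed.

HB.instance Definition _ :=
  Lmodule_isNormed.Build R clin opnormD opnormZ opnorm0_eq0.

Lemma clin_normE (f : clin) :
  `|f| = sup [set `|f x| | x in [set x | `|x| <= 1]].
Proof. by []. Qed.

Lemma ler_clin_norm (f : clin) (x : X) : `|f x| <= `|f| * `|x|.
Proof. exact: le_opnorm. Qed.

End continuous_linear.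

(* R^o is R seen as a normed space over itself. *)
Notation dual X := (clin X _^o).

Section composition.
Variables (R : realType) (X Y Z : normedModType R).

Lemma clin_comp_subproof (g : clin Y Z) (f : clin X Y) :
  g \o f \in @clin_pred R X Z.
Proof.
apply/mem_set; split=> [a x y|x]; first by rewrite /= !linearP.
by apply: continuous_comp; exact: clin_continuous.
Qed.

Definition clin_comp (g : clin Y Z) (f : clin X Y) : clin X Z :=
  CLin (clin_comp_subproof g f).

Lemma clin_comp_norm (g : clin Y Z) (f : clin X Y) :
  `|clin_comp g f| <= `|g| * `|f|.
Proof.
apply: opnorm_le => [|x]; first by rewrite mulr_ge0.
rewrite (le_trans (ler_clin_norm g (f x)))// -mulrA.
by rewrite ler_wpM2l// ler_clin_norm.
Qed.

End composition.

(* The multiplication of clin X X is the composition, so that A ^+ n is the n-th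
   iterate of A; the ring is possibly trivial since X may be {0}. *)
Section endomorphism_ring.
Variables (R : realType) (X : normedModType R).

Lemma clin_id_subproof : id \in @clin_pred R X X.
Proof. by apply/mem_set; split=> // x; exact: cvg_id. Qed.

Definition clin_id : clin X X := CLin clin_id_subproof.

Let clin_mulA : associative (@clin_comp R X X X).
Proof. by move=> f g h; apply/clin_eqP. Qed.

Let clin_mul1r : left_id clin_id (@clin_comp R X X X).
Proof. by move=> f; apply/clin_eqP. Qed.

Let clin_mulr1 : right_id clin_id (@clin_comp R X X X).
Proof. by move=> f; apply/clin_eqP. Qed.

Let clin_mulDl : left_distributive (@clin_comp R X X X) +%R.
Proof. by move=> f g h; apply/clin_eqP. Qed.

Let clin_mulDr : right_distributive (@clin_comp R X X X) +%R.
Proof. by move=> f g h; apply/clin_eqP => x; rewrite /= linearD. Qed.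

HB.instance Definition _ := GRing.Zmodule_isPzRing.Build (clin X X)
  clin_mulA clin_mul1r clin_mulr1 clin_mulDl clin_mulDr.

Lemma clin_mulE (f g : clin X X) (x : X) : (f * g) x = f (g x).
Proof. by []. Qed.

Lemma clin_exprE (f : clin X X) (n : nat) (x : X) : (f ^+ n) x = iter n f x.
Proof. by elim: n => // n IH; rewrite exprS clin_mulE IH. Qed.

End endomorphism_ring.

Section adjoint.
Variables (R : realType) (X Y : normedModType R).

Lemma adjoint_subproof (A : clin X Y) :
  (fun f : dual Y => clin_comp f A) \in @clin_pred R (dual Y) (dual X).
Proof.
have lA : linear (fun f : dual Y => clin_comp f A : dual X).
  by move=> a f g; apply/clin_eqP.
pose L : {linear dual Y -> dual X} :=
  HB.pack (fun f : dual Y => clin_comp f A : dual X)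
    (GRing.isLinear.Build _ _ _ _ _ lA).
apply/mem_set; split => //.
apply: (@bounded_linear_continuous _ _ _ L); apply/bounded_funP => r.
exists (r * `|A|) => f fr; apply: (le_trans (clin_comp_norm _ _)).
by rewrite ler_wpM2r.
Qed.

Definition adjoint (A : clin X Y) : clin (dual Y) (dual X) :=
  CLin (adjoint_subproof A).

Lemma adjointE (A : clin X Y) (f : dual Y) (x : X) : adjoint A f x = f (A x).
Proof. by []. Qed.

Lemma tensor_subproof (f : dual X) (u : Y) :
  (fun x => f x *: u) \in @clin_pred R X Y.
Proof.
apply/mem_set; split=> [a x y|x]; first by rewrite linearP scalerDl scalerA.
by apply: cvgZr_tmp; exact: clin_continuous.
Qed.

Definition tensor (f : dual X) (u : Y) : clin X Y := CLin (tensor_subproof f u).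

End adjoint.

Section cones.
Variables (R : realType) (X : normedModType R).

Definition cone (K : set X) :=
  [/\ K !=set0,
      forall (x y : X) (a b : R),
        K x -> K y -> 0 <= a -> 0 <= b -> K (a *: x + b *: y)
    & forall x : X, K x -> K (- x) -> x = 0].

Definition normal_cone (K : set X) :=
  exists2 d : R, 0 < d & forall x y : X, K x -> K y ->
    d * Num.max `|x| `|y| <= `|x + y|.

Definition dual_cone (K : set X) : set (dual X) :=
  [set f : dual X | forall x, K x -> 0 <= f x].

Definition positive_operator (K : set X) (A : clin X X) := A @` K `<=` K.

Definition strongly_positive (K : set X) (A : clin X X) :=
  A @` (K `\ 0) `<=` K°.

End cones.

Definition compact_operator (R : realType) (X Y : normedModType R)
    (A : clin X Y) :=
  forall B : set X, bounded_set B -> precompact (A @` B).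

(* The topology sigma(X', X): the coarsest one on X' for which all the
   evaluations f |-> f x are continuous. *)
Definition weak_star (R : realType) (X : normedModType R) :=
  initial_topology (fun f : dual X => (f : X -> R^o) : {ptws X -> R^o}).

(* The type is given explicitly because nbhs f alone would be taken in the
   norm topology of X'. *)
Definition weak_star_cvg (R : realType) (X : normedModType R)
    (F : set_system (dual X)) (f : dual X) :=
  cvg_to F (@nbhs (weak_star X) (weak_star X) f).

Notation "{ 'weak*' , F --> f }" := (weak_star_cvg F f)
  (at level 0, F at level 69, f at level 69,
   format "{ 'weak*' ,  F  -->  f }") : classical_set_scope.

Lemma weak_star_cvgP (R : realType) (X : normedModType R)
    (F : set_system (dual X)) (f : dual X) : Filter F ->
  {weak*, F --> f} <-> forall x : X, g x @[g --> F] --> f x.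
Proof.
move=> FF; pose ev (g : dual X) : {ptws X -> R^o} := g : X -> R^o.
have evP : {weak*, F --> f} <-> ev @ F --> ev f.
  split=> [cF|cF B [_ [[C oC <-] Cf CB]]].
    apply: (@cvg_comp _ _ _ (idfun : dual X -> weak_star X) ev F _ _ cF).
    exact: (@initial_continuous _ _ ev f).
  by apply: (filterS CB); apply: cF; apply: open_nbhs_nbhs.
rewrite evP; exact: (@pointwise_cvgP X R^o (ev @ F) (ev f)).
Qed.

Definition op_eigenspace (R : realType) (V : lmodType R) (T : V -> V) (a : R) :
    set V :=
  [set v | T v = a *: v].

Definition simple_eigenvalue (R : realType) (V : lmodType R) (T : V -> V)
    (a : R) :=
  exists2 v : V, v != 0 & op_eigenspace T a = [set c *: v | c in [set: R]].

(* Main.v *)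
Require Import Defs.
From HB Require Import structures.
From mathcomp Require Import all_boot all_order all_algebra.
From mathcomp Require Import all_classical all_reals all_analysis.
From mathcomp Require Import ring lra.

(** The limit is found by an order contraction around a fixed vector, without
    spectral theory: the dominant eigenvector, the dual eigenvector and the
    convergence in norm all come from compactness and strong positivity.

    Fix [e] in the interior of [K]. Since the cone is normal, the norm of a
    positive operator is controlled by its value at [e]
    ([norm_positive_operator]). So if the orbit of [e] comes arbitrarily close
    to [0], the powers of [A], being bounded, tend to [0] in norm, and the
    limit is [0] ([power_vanish]). Otherwise the orbit stays away from [0], and
    a cluster point of the images under a compact power of its Cesaro means is
    a fixed vector [u]; a uniform form of strong positivity on compact sets
    ([uniform_positivity]) shows that [u] is an interior vector
    ([fixed_vector]).

    With such a [u], every vector [x] lies between two multiples of [u], and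
    the iterates of [x] remain between them. Let [A ^+ p] be strongly positive,
    [A ^+ k] compact, and [s = p + k]. For [x] between [0] and [u], the two
    hypotheses together give an [eps], the same for all [x], such that
    [A ^+ s x] lies above [eps *: u] or below [(1 - eps) *: u]
    ([oscillation_unit]). By affine invariance, [s] further steps always shrink
    the interval that contains the orbit by the factor [1 - eps]. Hence the
    powers of [A] form a Cauchy sequence in operator norm, with a geometric
    rate ([power_cauchy]), and converge to an operator [A0].

    The values of [A0] are fixed vectors of [A], and these are the multiples
    of [u] ([fixed_line]); so [A0] is of the form [tensor f0 u], and the
    properties of [f0] are read off from this ([limit_tensor]). Simplicity of
    the eigenvalue [1] follows by passing to the limit: [A v = v] gives
    [v = A0 v = f0 v *: u], and a functional [f] fixed by the adjoint satisfies
    [f x = f (A0 x) = f u * f0 x]. *)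

Set Implicit Arguments.
Unset Strict Implicit.
Unset Printing Implicit Defensive.

Import Order.TTheory GRing.Theory Num.Theory.
Import numFieldNormedType.Exports.

Local Open Scope classical_set_scope.
Local Open Scope ring_scope.

(** * Bounded operators: powers, adjoints and norm limits *)

Lemma clin_exprD (R : realType) (X : normedModType R) (A : clin X X) m n x :
  (A ^+ (m + n)) x = (A ^+ m) ((A ^+ n) x).
Proof. by rewrite exprD. Qed.

Lemma expr_fixed (R : realType) (X : normedModType R) (A : clin X X) n x :
  A x = x -> (A ^+ n) x = x.
Proof. by move=> Ax; rewrite clin_exprE; elim: n => //= n ->. Qed.

Lemma adjoint_norm (R : realType) (X Y : normedModType R) (T : clin X Y) :
  `|adjoint T| <= `|T|.
Proof. by apply: opnorm_le => // f; rewrite mulrC; exact: clin_comp_norm. Qed.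

Lemma adjointB (R : realType) (X Y : normedModType R) (S T : clin X Y) :
  adjoint (S - T) = adjoint S - adjoint T.
Proof.
by apply/clin_eqP => f; apply/clin_eqP => x; exact: (linearB f).
Qed.

Lemma adjoint_expr (R : realType) (X : normedModType R) (A : clin X X) n :
  adjoint (A ^+ n) = adjoint A ^+ n.
Proof.
apply/clin_eqP => f; elim: n f => [|n IH] f; first by apply/clin_eqP.
rewrite [in RHS]exprS clin_mulE -IH; apply/clin_eqP => x.
by rewrite !adjointE exprSr.
Qed.

Lemma cvg_adjoint_norm (R : realType) (X Y : normedModType R)
    (T : nat -> clin X Y) (T0 : clin X Y) :
  `|T n - T0| @[n --> \oo] --> (0 : R) ->
  `|adjoint (T n) - adjoint T0| @[n --> \oo] --> (0 : R).
Proof.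
move=> TT0; apply: (squeeze_cvgr _ (cvg_cst 0) TT0).
by apply: nearW => n; rewrite -adjointB normr_ge0 adjoint_norm.
Qed.

Lemma cvg_clin_norm (R : realType) (X Y : normedModType R)
    (T : nat -> clin X Y) (T0 : clin X Y) :
  `|T n - T0| @[n --> \oo] --> (0 : R) ->
  forall x, T n x @[n --> \oo] --> T0 x.
Proof.
move=> TT0 x; apply/cvgrPdist_le => eps e0.
have lim0 : `|T n - T0| * `|x| @[n --> \oo] --> (0 : R).
  by rewrite -[X in _ --> X](mul0r `|x|); apply: cvgM; [|exact: cvg_cst].
have /cvgrPdist_le/(_ _ e0) := lim0; apply: filterS => n.
rewrite sub0r normrN => /(le_trans (ler_norm _)); apply: le_trans.
by rewrite distrC; exact: (ler_clin_norm (T n - T0) x).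
Qed.

(** Completeness of the operator norm: the pointwise limits exist because [Y]
    is complete, and the Cauchy estimate, uniform in the vector, passes to the
    limit in its second index, giving both the boundedness of the limit and
    the convergence in norm. *)
Lemma clin_cauchy_cvg (R : realType) (X : normedModType R)
    (Y : completeNormedModType R) (T : nat -> clin X Y) :
  (forall eps : R, 0 < eps -> exists N, forall n l,
     (N <= n)%N -> (N <= l)%N -> `|T n - T l| <= eps) ->
  exists T0 : clin X Y, `|T n - T0| @[n --> \oo] --> (0 : R).
Proof.
move=> cT.
have cTx x : cvg (T n x @[n --> \oo]).
  apply/cauchy_cvgP/cauchyP => eps e0.
  have x1 : 0 < `|x| + 1 by rewrite ltr_wpDl.
  have [N TN] := cT (eps / 2 / (`|x| + 1)) ltac:(by rewrite !divr_gt0).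
  exists (T N x).
  rewrite -[_ _]/(\forall n \near \oo, ball (T N x) eps (T n x)).
  near=> n; rewrite -ball_normE /=.
  apply: (@le_lt_trans _ _ (eps / 2)); last by lra.
  have Nn : (N <= n)%N by near: n; exact: nbhs_infty_ge.
  apply: (le_trans (ler_clin_norm (T N - T n) x)).
  rewrite -[leRHS](@divfK _ (`|x| + 1)) ?gt_eqF//.
  by rewrite ler_pM// ?TN// lerDl.
pose T0 x := lim (T n x @[n --> \oo]).
have T0E x y : (T n x @[n --> \oo] --> y) -> T0 x = y by exact: cvg_lim.
have lT0 : linear T0.
  move=> a x y; apply: T0E.
  rewrite (_ : (fun n => _) = fun n => a *: T n x + T n y); last first.
    by apply/funext => n; rewrite linearP.
  by apply: cvgD; [apply: cvgZl_tmp|]; exact: cTx.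
have unif (eps : R) N :
    (forall n l, (N <= n)%N -> (N <= l)%N -> `|T n - T l| <= eps) ->
    forall n x, (N <= n)%N -> `|T n x - T0 x| <= eps * `|x|.
  move=> TN n x Nn.
  have c : `|T n x - T l x| @[l --> \oo] --> `|T n x - T0 x|.
    by apply: cvg_norm; apply: cvgB; [exact: cvg_cst|exact: cTx].
  rewrite -(cvg_lim _ c)//; apply: limr_le.
    by apply/cvg_ex; eexists; exact: c.
  near=> l.
  apply: (le_trans (ler_clin_norm (T n - T l) x)).
  rewrite ler_wpM2r// TN//; near: l; exact: nbhs_infty_ge.
pose L : {linear X -> Y} := HB.pack T0 (GRing.isLinear.Build _ _ _ _ _ lT0).
have cT0 : continuous T0.
  apply: (@bounded_linear_continuous _ _ _ L); apply/bounded_funP => r.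
  have [N TN] := cT 1 ltr01.
  exists (`|T N| * r + r) => x xr.
  have -> : L x = T N x - (T N x - T0 x) by rewrite subKr.
  apply: (le_trans (ler_normB _ _)); apply: lerD.
    by apply: (le_trans (ler_clin_norm _ _)); rewrite ler_wpM2l.
  by apply: (le_trans (unif _ _ TN _ _ (leqnn N))); rewrite mul1r.
exists (mk_clin lT0 cT0); apply/cvgrPdist_le => eps e0.
have [N TN] := cT _ e0; near=> n.
rewrite sub0r normrN normr_id; apply: opnorm_le => [|x]; first exact: ltW.
by apply: (unif _ _ TN); near: n; exact: nbhs_infty_ge.
Unshelve. all: by end_near. Qed.

(** * The order of a cone, normality and interior points *)

Section cone_order.
Variables (R : realType) (X : normedModType R) (K : set X).
Hypothesis coneK : cone K.

Local Notation "x <=K y" := (K (y - x)) (at level 70, y at next level).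

Lemma cone_comb a b x y : 0 <= a -> 0 <= b -> K x -> K y -> K (a *: x + b *: y).
Proof. by case: coneK => _ H _ a0 b0 Kx Ky; exact: H. Qed.

Lemma coneD x y : K x -> K y -> K (x + y).
Proof. by move=> Kx Ky; rewrite -[x]scale1r -[y]scale1r; exact: cone_comb. Qed.

Lemma coneZ a x : 0 <= a -> K x -> K (a *: x).
Proof.
by move=> a0 Kx; rewrite -[_ *: _]addr0 -(scale0r x); exact: cone_comb.
Qed.

Lemma cone0 : K 0.
Proof. by case: coneK => -[x Kx] _ _; rewrite -(scale0r x); exact: coneZ. Qed.

Lemma cone_pointed x : K x -> K (- x) -> x = 0.
Proof. by case: coneK => _ _; exact. Qed.

Lemma cone_le_trans y x z : x <=K y -> y <=K z -> x <=K z.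
Proof. by move=> xy yz; rewrite -(subrK y z) -addrA; exact: coneD. Qed.

Lemma cone_leZr a b x : K x -> a <= b -> a *: x <=K b *: x.
Proof. by move=> Kx ab; rewrite -scalerBl; apply: coneZ; rewrite ?subr_ge0. Qed.

Lemma cone_leZl a b u : K u -> u <> 0 ->
  a *: u <=K b *: u -> a <= b.
Proof.
move=> Ku u0; rewrite -scalerBl => Kab; rewrite leNgt.
apply/negP => ba; apply: u0.
apply: cone_pointed => //.
have ab : 0 < a - b by rewrite subr_gt0.
rewrite -[u](scalerK (lt0r_neq0 ab)) -scalerN -scaleNr opprB.
by apply: coneZ; rewrite // invr_ge0 ltW.
Qed.

Lemma cone_sum (F : nat -> X) n : (forall i, K (F i)) -> K (\sum_(i < n) F i).
Proof. by move=> KF; apply: (big_ind K) => //; [exact: cone0|exact: coneD]. Qed.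

(** Normality in the form in which it is used: the norm is monotone on the cone
    up to a constant. *)
Lemma normal_le : normal_cone K ->
  exists2 D : R, 0 < D & forall x y, K x -> x <=K y -> `|x| <= D * `|y|.
Proof.
move=> [d d0 H]; exists d^-1 => [|x y Kx xy]; first by rewrite invr_gt0.
have := H _ _ Kx xy; rewrite subrKC => h.
rewrite mulrC ler_pdivlMr// mulrC; apply: le_trans h.
by rewrite ler_pM2l// le_max lexx.
Qed.

(** Interior vectors are order units. With [- x] in place of [x] this bounds
    [x] from both sides by multiples of [e] of size proportional to its norm. *)
Lemma interior_absorb e : K° e ->
  exists2 C : R, 0 < C & forall x, x <=K (C * `|x|) *: e.
Proof.
rewrite /interior => /nbhs_ballP[r /= r0 rK].
exists (2 / r) => [|x]; first by rewrite divr_gt0.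
have [->|x0] := eqVneq x 0.
  by rewrite normr0 mulr0 scale0r subr0; exact: cone0.
have nx : 0 < `|x| by rewrite normr_gt0.
have -> : (2 / r * `|x|) *: e - x =
    (2 / r * `|x|) *: (e - (r / 2 / `|x|) *: x).
  rewrite scalerBr scalerA; congr (_ - _).
  rewrite -[LHS]scale1r; congr (_ *: _).
  by field; rewrite !gt_eqF.
apply: coneZ; first by rewrite !mulr_ge0// invr_ge0 ltW.
apply: rK; rewrite -ball_normE /= opprB subrKC normrZ.
rewrite normrM normfV normr_id -mulrA mulVf ?gt_eqF// mulr1.
by rewrite gtr0_norm; lra.
Qed.

Lemma interior_dominates z y : K° z -> exists2 d : R, 0 < d & d *: y <=K z.
Proof.
move=> Kz; have [C C0 CK] := interior_absorb Kz.
have t0 : 0 < C * `|y| + 1 by rewrite ltr_wpDl// mulr_ge0// ltW.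
exists (C * `|y| + 1)^-1; first by rewrite invr_gt0.
rewrite -[z](scalerK (lt0r_neq0 t0)) -scalerBr.
apply: coneZ => //; first by rewrite invr_ge0 ltW.
apply: (cone_le_trans (CK y)); apply: cone_leZr => //.
  exact: interior_subset.
by rewrite lerDl.
Qed.

Lemma interior_up e u (eps : R) : K° e -> 0 < eps -> eps *: e <=K u -> K° u.
Proof.
move=> Ke e0 eu; have [C C0 CK] := interior_absorb Ke.
have Ku : K u.
  rewrite -(subrK (eps *: e) u); apply: coneD => //; apply: coneZ.
    exact: ltW.
  exact: interior_subset.
rewrite /interior; apply/nbhs_ballP; exists (eps / C) => /=.
  by rewrite divr_gt0.
move=> y; rewrite -ball_normE /= => uy.
set x := u - y in uy.
(* The first two summands are nonnegative by the choice of C and by eu, the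
   third one because y lies within eps / C of u. *)
have -> : y = ((C * `|x|) *: e - x) + (C * `|x| / eps) *: (u - eps *: e)
    + (1 - C * `|x| / eps) *: u.
  rewrite scalerBr scalerA divfK ?gt_eqF// scalerBl scale1r.
  rewrite (addrC (_ - x)) (addrA _ _ (- x)) subrK addrC.
  by rewrite -addrA subrKC addrC /x subKr.
apply: coneD; first apply: coneD => //; apply: coneZ => //.
  by rewrite !mulr_ge0// ?invr_ge0// ltW.
rewrite subr_ge0 ler_pdivrMr// mul1r mulrC -ler_pdivlMr//; exact: ltW.
Qed.

(** Closedness of the cone along one ray makes suprema of order bounds
    attained. *)
Lemma cone_closed_limit x y : closed K ->
  (forall eta : R, 0 < eta -> K (x + eta *: y)) -> K x.
Proof.
move=> cK H.
apply: (@closed_cvg _ _ (0:R)^'+ _ (fun t => x + t *: y) K cK).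
  by near=> t; apply: H; near: t; exact: nbhs_right_gt.
rewrite -[X in _ --> X]addr0 -[X in x + X](scale0r y).
apply: cvgD; first exact: cvg_cst.
by apply: cvgZr_tmp; apply: cvg_at_right_filter; exact: cvg_id.
Unshelve. all: by end_near. Qed.

End cone_order.

(** * Uniform strong positivity on compact sets *)

Section uniform_positivity.
Variables (R : realType) (X : normedModType R) (K : set X).
Hypothesis closedK : closed K.

Local Notation "x <=K y" := (K (y - x)) (at level 70, y at next level).

(** A strongly positive operator pushes each nonzero vector of the cone into the
    interior, but by an amount that depends on the vector. On the relevant
    values of a compact operator [T] the amount is uniform: those with norm at
    least [c] lie in a compact subset of [K \ 0], which [P] maps into the open
    set [K°], and a compact subset of an open set can be shifted a little. *)
Lemma uniform_positivity (T P : clin X X) (e : X) (r c : R) :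
  compact_operator T -> strongly_positive K P -> 0 < c ->
  exists2 eps : R, 0 < eps & forall y,
    `|y| <= r -> K (T y) -> c <= `|T y| -> eps *: e <=K P (T y).
Proof.
move=> cT sP c0.
pose B := [set y : X | `|y| <= r].
pose S := closure (T @` B) `&` (K `&` [set z : X | c <= `|z|]).
have cptS : compact S.
  apply: compact_closedI.
    rewrite -precompactE; apply: cT.
    rewrite /= /bounded_near; near=> b => y By; apply: (le_trans By).
    by near: b; apply: nbhs_pinfty_ge; exact: num_real.
  apply: closedI => //.
  apply: (@preimage_closed _ _ (fun z : X => `|z|) [set t : R | c <= t]).
    by move=> z _; exact: norm_continuous.
  exact: closed_ge.
have : \forall t \near (0 : R), S `<=` [set z | t *: e <=K P z].
  move/compact_near_coveringP : cptS => ncS.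
  apply: (ncS _ (nbhs (0 : R)) (fun t z => t *: e <=K P z)) => z [_ [Kz cz]].
  have KPz : K° (P z).
    apply: sP; exists z => //; split => //= z0.
    by move: cz; rewrite /= z0 normr0 leNgt c0.
  have : (fun zt : X * R => P zt.1 - zt.2 *: e) @ (z, 0 : R) -->
      P z - (0 : R) *: e.
    apply: cvgB.
      by apply: (@cvg_comp _ _ _ fst P);
        [exact: cvg_fst|exact: clin_continuous].
    by apply: cvgZr_tmp; exact: cvg_snd.
  by rewrite scale0r subr0; apply.
move/nbhs_ballP => [d /= d0 dS]; exists (d / 2); first by lra.
move=> y yr KTy cTy; apply: (dS (d / 2)).
  by rewrite -ball_normE /= sub0r normrN gtr0_norm; lra.
by split=> //; apply: subset_closure; exists y.
Unshelve. all: by end_near. Qed.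

End uniform_positivity.

(** * Powers of a positive operator: decay or a fixed interior vector *)

Lemma cluster_closed (T : topologicalType) (F : set_system T) (C : set T) x :
  cluster F x -> closed C -> F C -> C x.
Proof. by move=> Fx cC FC; apply: cC => B Bx; exact: Fx. Qed.

Section power_bounded.
Variables (R : realType) (X : normedModType R) (K : set X).
Hypotheses (coneK : cone K) (closedK : closed K) (normalK : normal_cone K).
Variables (A : clin X X) (posA : positive_operator K A).

Local Notation "x <=K y" := (K (y - x)) (at level 70, y at next level).

Lemma positive_expr n : positive_operator K (A ^+ n).
Proof.
move=> _ [x Kx <-]; rewrite clin_exprE; elim: n => //= n IH.
by apply: posA; exists (iter n A x).
Qed.

Lemma positive_le (T : clin X X) x y :
  positive_operator K T -> x <=K y -> T x <=K T y.
Proof. by move=> pT xy; rewrite -linearB; apply: pT; exists (y - x). Qed.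

(** The norm of a positive operator is controlled by its value at an order
    unit: [x] lies between multiples of [e], so [T x] lies between multiples of
    [T e], and normality turns this into a norm estimate. *)
Lemma norm_positive_operator e : K° e ->
  exists2 L : R, 0 < L &
    forall T : clin X X, positive_operator K T -> `|T| <= L * `|T e|.
Proof.
move=> Ke; have [C C0 CK] := interior_absorb coneK Ke.
have [D D0 DK] := normal_le normalK.
exists ((D * 2 + 1) * C) => [|T pT].
  by rewrite mulr_gt0// addr_gt0// mulr_gt0.
have Te (x : X) : T (- x) <=K (C * `|x|) *: T e.
  by rewrite -linearZ -normrN; apply: positive_le => //; exact: CK.
apply: opnorm_le => [|x].
  by rewrite !mulr_ge0// ?addr_ge0 ?mulr_ge0// ltW.
(* The vector T x + w lies between 0 and 2 w. *)
pose w := (C * `|x|) *: T e.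
have w0 : K (T x + w) by have := Te x; rewrite linearN opprK addrC.
have ww : T x + w <=K w + w.
  by rewrite opprD addrACA subrr addr0; have := Te (- x); rewrite opprK normrN.
rewrite -[T x](addrK w); apply: (le_trans (ler_normB _ _)).
have nw : `|w| = C * `|x| * `|T e|.
  by rewrite normrZ ger0_norm// mulr_ge0// ltW.
apply: (@le_trans _ _ (D * (`|w| + `|w|) + `|w|)); last by rewrite nw; lra.
rewrite lerD2r; apply: (le_trans (DK _ _ w0 ww)).
by rewrite ler_pM2l// ler_normD.
Qed.

Variable M : R.
Hypothesis bndA : forall n, `|A ^+ n| <= M.

Lemma norm_expr_le n x : `|(A ^+ n) x| <= M * `|x|.
Proof. by apply: (le_trans (ler_clin_norm _ _)); rewrite ler_wpM2r. Qed.

(** Once [A ^+ n e] is small it stays small, because the powers are bounded. *)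
Lemma power_vanish e : K° e ->
  (forall eta : R, 0 < eta -> exists n, `|(A ^+ n) e| < eta) ->
  `|A ^+ n| @[n --> \oo] --> (0 : R).
Proof.
move=> Ke small; have [L L0 LA] := norm_positive_operator Ke.
have M0 : 0 <= M by apply: le_trans (bndA 0).
apply/cvgrPdist_le => eps e0.
have d0 : 0 < eps / (L * (M + 1)) by rewrite divr_gt0// mulr_gt0// ltr_wpDl.
have [N AN] := small _ d0.
near=> n; rewrite sub0r normrN normr_id.
have Nn : (N <= n)%N by near: n; exact: nbhs_infty_ge.
apply: (le_trans (LA _ (@positive_expr n))).
rewrite -(subnK Nn) clin_exprD.
apply: (@le_trans _ _ (L * ((M + 1) * `|(A ^+ N) e|))).
  rewrite ler_pM2l//; apply: (le_trans (norm_expr_le _ _)).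
  by rewrite ler_wpM2r// lerDl.
by rewrite mulrA -ler_pdivlMl ?mulr_gt0 ?ltr_wpDl// mulrC ltW.
Unshelve. all: by end_near. Qed.

Variables p k : nat.
Hypothesis strA : strongly_positive K (A ^+ p).
Hypothesis cptA : compact_operator (A ^+ k).

(** Mean ergodic argument. The images under [A ^+ k] of the Cesaro means of
    the orbit of [e] stay in a compact set, and [A - 1] sends them to [0] by
    telescoping, so every cluster point is fixed. Such a point could vanish a
    priori, since normality bounds the norm of a sum from below only by its
    largest term, which the averaging divides by [n.+1]. But the orbit stays
    away from [0], hence [A ^+ (p + k)] maps all its points, and therefore their
    means, above one and the same positive multiple of [e]. *)
Lemma fixed_vector e (c : R) : K° e -> 0 < c ->
  (forall n, c <= `|(A ^+ n) e|) -> exists u, [/\ K° u, A u = u & u <> 0].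
Proof.
move=> Ke c0 Ac.
have Ke' : K e by exact: interior_subset.
have M0 : 0 <= M by apply: le_trans (bndA 0).
pose avg n := n.+1%:R^-1 *: \sum_(i < n.+1) (A ^+ i) e.
pose y n := (A ^+ k) (avg n).
have ni n : 0 <= n.+1%:R^-1 :> R by rewrite invr_ge0.
have avg_le n : `|avg n| <= M * `|e|.
  rewrite normrZ ger0_norm// mulrC ler_pdivrMr//.
  apply: (le_trans (ler_norm_sum _ _ _)).
  apply: (@le_trans _ _ (\sum_(i < n.+1) M * `|e|)).
    by apply: ler_sum => i _; exact: norm_expr_le.
  by rewrite sumr_const card_ord mulr_natr.
have [eps e0 He] := uniform_positivity closedK e (M * `|e|) cptA strA c0.
have avg_ge n : eps *: e <=K (A ^+ p) (y n).
  have -> : (A ^+ p) (y n) - eps *: e =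
    n.+1%:R^-1 *: \sum_(i < n.+1) ((A ^+ p) ((A ^+ k) ((A ^+ i) e)) - eps *: e).
    rewrite sumrB sumr_const card_ord scalerBr -(scaler_nat _ (eps *: e)).
    rewrite scalerK//.
    by rewrite /y /avg !linearZ/= !linear_sum.
  apply: coneZ => //; apply: (@cone_sum _ _ _ coneK
    (fun i => (A ^+ p) ((A ^+ k) ((A ^+ i) e)) - eps *: e)) => i.
  apply: He; first exact: norm_expr_le.
  - by rewrite -clin_exprD; apply: positive_expr; exists e.
  - by rewrite -clin_exprD; exact: Ac.
have avg_fix n : `|A (y n) - y n| <= M * (M * `|e| + `|e|) * n.+1%:R^-1.
  have -> : A (y n) - y n = (A ^+ k) (n.+1%:R^-1 *: ((A ^+ n.+1) e - e)).
    rewrite /y -[A (_ _)]/((A * A ^+ k) _) -exprS exprSr clin_mulE -linearB.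
    congr (_ _); rewrite /avg linearZ/= -scalerBr linear_sum; congr (_ *: _).
    under [X in X - _]eq_bigr => i _ do
      rewrite -[_ ((A ^+ i) e)]/((A * A ^+ i) e) -exprS.
    rewrite -(big_mkord xpredT (fun i => (A ^+ i.+1) e)).
    rewrite -(big_mkord xpredT (fun i => (A ^+ i) e)) -sumrB telescope_sumr//.
  apply: (le_trans (norm_expr_le _ _)); rewrite -mulrA ler_wpM2l//.
  rewrite normrZ ger0_norm// mulrC ler_wpM2r//.
  by apply: (le_trans (ler_normB _ _)); rewrite lerD2r norm_expr_le.
pose S := closure ((A ^+ k) @` [set x : X | `|x| <= M * `|e|]).
have cptS : compact S.
  rewrite /S -precompactE; apply: cptA.
  rewrite /= /bounded_near; near=> b => x xb; apply: (le_trans xb).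
  by near: b; apply: nbhs_pinfty_ge; exact: num_real.
have [u [Su clu]] : S `&` cluster (y n @[n --> \oo]) !=set0.
  apply: cptS; exists 0%N => // n _. apply: subset_closure.
  by exists (avg n) => //; exact: avg_le.
have Au : A u = u.
  apply/eqP; rewrite -subr_eq0 -normr_le0; apply/ler_addgt0Pl => eta eta0.
  rewrite addr0.
  apply: (cluster_closed (C := [set z | `|A z - z| <= eta]) clu).
    apply: (@preimage_closed _ _ (fun z : X => `|A z - z|)
      [set t : R | t <= eta]).
      move=> z _; apply: (@continuous_comp _ _ _ (fun z => A z - z) Num.norm).
        by apply: continuousB; [exact: clin_continuous|exact: cvg_id].
      exact: norm_continuous.
    exact: closed_le.
  have lim0 : M * (M * `|e| + `|e|) * harmonic n @[n --> \oo] --> (0 : R).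
    rewrite -[X in _ --> X](mulr0 (M * (M * `|e| + `|e|))).
    by apply: cvgM; [exact: cvg_cst|exact: cvg_harmonic].
  have /cvgrPdist_le/(_ _ eta0) := lim0; apply: filterS => n /=.
  rewrite sub0r normrN => /(le_trans (ler_norm _)); apply: le_trans.
  exact: avg_fix.
have eu : eps *: e <=K u.
  rewrite -(expr_fixed p Au).
  apply: (cluster_closed (C := [set z | eps *: e <=K (A ^+ p) z]) clu).
    apply: (@preimage_closed _ _ (fun z : X => (A ^+ p) z - eps *: e) K) => //.
    move=> z _.
    by apply: continuousB; [exact: clin_continuous|exact: cst_continuous].
  by exists 0%N => // n _; exact: avg_ge.
exists u; split => // [|u0]; first exact: (interior_up coneK Ke e0 eu).
have /eqP : eps *: e = 0.
  apply: (cone_pointed coneK); first by apply: coneZ => //; exact: ltW.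
  by rewrite -[- _]add0r -[X in X - _]u0.
rewrite scaler_eq0 gt_eqF//= => /eqP ee.
by have := Ac 0; rewrite expr0 ee linear0 normr0 leNgt c0.
Unshelve. all: by end_near. Qed.

End power_bounded.

(** * Contraction of the order oscillation around a fixed interior vector *)

Section fixed_interior_vector.
Variables (R : realType) (X : normedModType R) (K : set X).
Hypotheses (coneK : cone K) (closedK : closed K) (normalK : normal_cone K).
Variables (A : clin X X) (posA : positive_operator K A).
Variables p k : nat.
Hypothesis strA : strongly_positive K (A ^+ p).
Hypothesis cptA : compact_operator (A ^+ k).
Variable u : X.
Hypotheses (Ku : K° u) (Au : A u = u) (u0 : u <> 0).

Local Notation "x <=K y" := (K (y - x)) (at level 70, y at next level).

Let Ku' : K u. Proof. exact: interior_subset. Qed.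

(** The contraction that drives the theorem. Let [z] be the image under
    [A ^+ k] of a vector of the order interval from [0] to [u]. If [z] is small
    in norm then it lies below [u / 2], and so does [A ^+ p z] because [u] is
    fixed; otherwise [uniform_positivity] gives a lower bound for [A ^+ p z].
    In both cases one end of the interval moves inwards by a proportion which
    does not depend on the vector. *)
Lemma oscillation_unit : exists2 eps : R, 0 < eps <= 2^-1 &
  forall x, K x -> x <=K u ->
    eps *: u <=K (A ^+ (p + k)) x \/ (A ^+ (p + k)) x <=K (1 - eps) *: u.
Proof.
have [C C0 CK] := interior_absorb coneK Ku.
have [D D0 DK] := normal_le normalK.
have eta0 : 0 < (2 * C)^-1 by rewrite invr_gt0 mulr_gt0.
have [eps e0 He] := uniform_positivity closedK u (D * `|u|) cptA strA eta0.
have min0 : 0 < Num.min eps 2^-1 by rewrite lt_min e0 invr_gt0 ltr0n.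
(* The bound 1 / 2 covers the case of a small z, and it keeps the contraction
   factor 1 - eps positive. *)
exists (Num.min eps 2^-1); first by rewrite min0 ge_min lexx orbT.
move=> x Kx xu; rewrite clin_exprD.
have KAx : K ((A ^+ k) x) by apply: (positive_expr posA); exists x.
have [le|lt] := leP (2 * C)^-1 `|(A ^+ k) x|; [left|right].
  apply: (cone_le_trans coneK (y := eps *: u)).
    by apply: cone_leZr => //; rewrite ge_min lexx.
  by apply: He => //; exact: DK.
rewrite -[_ *: u](expr_fixed (A := A) p); last by rewrite linearZ/= Au.
apply: positive_le; first exact: positive_expr.
apply: (cone_le_trans coneK (CK _)); apply: cone_leZr => //.
apply: (@le_trans _ _ 2^-1).
  by move: lt; rewrite invfM ltr_pdivlMr// mulrC => /ltW.
have : Num.min eps 2^-1 <= 2^-1 by rewrite ge_min lexx orbT.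
by lra.
Qed.

(** The affine change of variables that carries the interval from [a *: u] to
    [b *: u] to the one from [0] to [u]. *)
Lemma oscillation_step (eps : R) (T : clin X X) a b x :
  positive_operator K T -> T u = u ->
  (forall x, K x -> x <=K u -> eps *: u <=K T x \/ T x <=K (1 - eps) *: u) ->
  a < b -> a *: u <=K x -> x <=K b *: u ->
  exists a' b', [/\ b' - a' = (1 - eps) * (b - a),
    a' *: u <=K T x & T x <=K b' *: u].
Proof.
move=> pT Tu HT ab ax xb.
have ba : 0 < b - a by rewrite subr_gt0.
pose z := (b - a)^-1 *: (x - a *: u).
have xz : x = (b - a) *: z + a *: u by rewrite scalerKV ?gt_eqF// subrK.
have Kz : K z by apply: coneZ; rewrite // invr_ge0 ltW.
have zu : z <=K u.
  rewrite -[X in X - _](scalerK (lt0r_neq0 ba)) -scalerBr.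
  apply: coneZ; rewrite // ?invr_ge0 ?ltW//.
  by rewrite scalerBl opprB addrA subrK.
clearbody z.
have Tx : T x = (b - a) *: T z + a *: u by rewrite xz linearP linearZ/= Tu.
have [ez|ze] := HT z Kz zu.
  exists (a + eps * (b - a)), b; split; first by ring.
    rewrite Tx (scalerDl u a) opprD addrA addrK (mulrC eps) -scalerA -scalerBr.
    by apply: coneZ => //; exact: ltW.
  by have := positive_le pT xb; rewrite linearZ/= Tu.
exists a, (a + (1 - eps) * (b - a)); split; first by ring.
  rewrite Tx addrK; apply: coneZ => //; first exact: ltW.
  by apply: pT; exists z.
rewrite Tx (scalerDl u a) [_ *: T z + _]addrC opprD addrACA subrr add0r.
rewrite (mulrC (1 - eps)) -scalerA -scalerBr.
by apply: coneZ => //; exact: ltW.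
Qed.

(** All powers of [A] preserve the order intervals with ends on the line of
    [u]. So after [j] blocks of [p + k] steps every orbit is trapped in such an
    interval of length proportional to [q ^+ j], and normality converts this
    into a norm estimate uniform in the starting vector. *)
Lemma power_cauchy : exists q D : R, [/\ 0 < q, q < 1 &
  forall j n l, ((p + k) * j <= n)%N -> ((p + k) * j <= l)%N ->
    `|A ^+ n - A ^+ l| <= D * q ^+ j].
Proof.
have [eps /andP[e0 e2] He] := oscillation_unit.
have [C C0 CK] := interior_absorb coneK Ku.
have [D D0 DK] := normal_le normalK.
pose q := 1 - eps; have q0 : 0 < q by rewrite /q; lra.
pose T := A ^+ (p + k).
(* The interval has positive length only for x <> 0, hence the separate case
   x = 0. *)
have iterT j x : exists a b, [/\ b - a = q ^+ j * (2 * (C * `|x|)),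
    a *: u <=K (T ^+ j) x & (T ^+ j) x <=K b *: u].
  have [->|x0] := eqVneq x 0.
    exists 0, 0; split; first by rewrite normr0 !mulr0 subrr.
      by rewrite linear0 scale0r subrr; exact: cone0.
    by rewrite linear0 scale0r subrr; exact: cone0.
  elim: j => [|j [a [b [ba aT Tb]]]].
    exists (- (C * `|x|)), (C * `|x|); split; first by ring.
      by rewrite scaleNr opprK addrC -[X in _ + X]opprK -normrN.
    exact: CK.
  have ab : a < b.
    by rewrite -subr_gt0 ba !mulr_gt0 ?exprn_gt0 ?normr_gt0.
  have [|a' [b' [ba' aT' Tb']]] :=
    oscillation_step (positive_expr posA (n := p + k)) _ He ab aT Tb.
    exact: expr_fixed.
  exists a', b'; rewrite (exprS T) clin_mulE; split => //.
  by rewrite ba' ba exprS mulrA.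
exists q, (2 * (D * (2 * C * `|u|))); split => //; first by rewrite /q; lra.
move=> j n l jn jl.
have E0 : 0 <= 2 * (D * (2 * C * `|u|)) * q ^+ j.
  by rewrite !mulr_ge0 ?exprn_ge0// ltW.
apply: opnorm_le => // x; have [a [b [ba aT Tb]]] := iterT j x.
have half i : ((p + k) * j <= i)%N ->
    `|(A ^+ i) x - a *: u| <= D * (2 * C * `|u|) * q ^+ j * `|x|.
  move=> ji.
  have Ai c : (A ^+ (i - (p + k) * j)) (c *: u) = c *: u.
    by rewrite linearZ/= expr_fixed.
  have Ax : (A ^+ i) x = (A ^+ (i - (p + k) * j)) ((T ^+ j) x).
    by rewrite -[RHS]/((A ^+ (i - (p + k) * j) * T ^+ j) x) -exprM -exprD subnK.
  have lo := positive_le (positive_expr posA (n := i - (p + k) * j)) aT.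
  have hi := positive_le (positive_expr posA (n := i - (p + k) * j)) Tb.
  rewrite Ai -Ax in lo; rewrite Ai -Ax in hi.
  have hi' : ((A ^+ i) x - a *: u) <=K (b - a) *: u.
    by rewrite scalerBl opprB addrA subrK.
  apply: (le_trans (DK _ _ lo hi')); rewrite normrZ ba ger0_norm; first lra.
  by rewrite !mulr_ge0 ?exprn_ge0// ltW.
rewrite [X in `|X|](_ : _ = (A ^+ n) x - (A ^+ l) x)//.
rewrite -[X in X - _](subrK (a *: u)) -addrA.
apply: (le_trans (ler_normD _ _)).
have := half n jn; have := half l jl.
rewrite -normrN opprB; lra.
Qed.

(** Subtract from a fixed vector the largest possible multiple of [u]. The
    remainder is fixed and lies in [K]; if it were not zero, strong positivity
    of [A ^+ p] would put it in the interior, where a further multiple of [u]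
    can be subtracted. *)
Lemma fixed_line x : A x = x -> exists c, x = c *: u.
Proof.
move=> Ax; have [C C0 CK] := interior_absorb coneK Ku.
pose E := [set t : R | t *: u <=K x].
have supE : has_sup E.
  split.
    exists (- (C * `|x|)).
    by rewrite /E /= scaleNr opprK addrC -[X in _ + X]opprK -normrN.
  exists (C * `|x|) => t /= tx; apply: (cone_leZl coneK Ku' u0).
  exact: (cone_le_trans coneK tx (CK x)).
pose c := sup E.
have Kc : c *: u <=K x.
  apply: (cone_closed_limit (y := u)) => // eta eta0.
  have [t tE ct] := sup_adherent eta0 supE.
  have -> : x - c *: u + eta *: u = x - (c - eta) *: u.
    by rewrite scalerBl opprB addrA addrAC.
  by apply: (cone_le_trans coneK _ tE); apply: cone_leZr => //; exact: ltW.
exists c; apply/eqP; rewrite -subr_eq0; apply/eqP; apply: contrapT => z0.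
have Kz : K° (x - c *: u).
  rewrite -[x - _](expr_fixed (A := A) p); last first.
    by rewrite linearB linearZ/= Ax Au.
  by apply: strA; exists (x - c *: u).
have [d d0 dz] := interior_dominates coneK u Kz.
have : c + d <= c.
  apply: (ub_le_sup (proj2 supE)).
  by rewrite /E /= scalerDl opprD addrA.
by rewrite gerDl leNgt d0.
Qed.

(** The limit takes its values among the fixed vectors, hence on the line of
    [u], and [f0] is its coordinate there. Positivity of [f0] is that of the
    limit, and its strictness holds because [f0 x = f0 (A ^+ p x)], where
    [A ^+ p x] is an interior vector and so lies above a multiple of [u]. *)
Lemma limit_tensor (A0 : clin X X) : `|A ^+ n - A0| @[n --> \oo] --> (0 : R) ->
  exists f0 : dual X, [/\ A0 = tensor f0 u, dual_cone K f0,
    adjoint A f0 = f0, f0 u = 1 & forall x, K x -> x <> 0 -> 0 < f0 x].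
Proof.
move=> /cvg_clin_norm A0E.
have A0ES x : (A ^+ n.+1) x @[n --> \oo] --> A0 x.
  by rewrite (cvg_shiftS (fun n => (A ^+ n) x)); exact: A0E.
have A0A x : A0 (A x) = A0 x.
  apply: (cvg_unique _ (A0E (A x))) => //=.
  rewrite (_ : (fun n => _) = fun n => (A ^+ n.+1) x); last first.
    by apply/funext => n; rewrite exprSr.
  exact: A0ES.
have AA0 x : A (A0 x) = A0 x.
  have c : A ((A ^+ n) x) @[n --> \oo] --> A (A0 x).
    by apply: (@cvg_comp _ _ _ (fun n => (A ^+ n) x) A);
      [exact: A0E|exact: clin_continuous].
  apply: (cvg_unique _ c) => //=.
  rewrite (_ : (fun n => _) = fun n => (A ^+ n.+1) x); last first.
    by apply/funext => n; rewrite exprS.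
  exact: A0ES.
have pA0 : positive_operator K A0.
  move=> _ [x Kx <-]; apply: (closed_cvg K closedK _ _ (A0E x)).
  by near=> n; apply: (positive_expr posA); exists x.
have A0u : A0 u = u.
  apply: (cvg_unique _ (A0E u)) => //=.
  rewrite (_ : (fun n => _) = fun n => u); first exact: cvg_cst.
  by apply/funext => n; exact: expr_fixed.
have /choice[f fE] x : exists c, A0 x = c *: u by exact: fixed_line.
have u0' : u != 0 by apply/eqP.
have inj a b : a *: u = b *: u -> a = b.
  move=> /eqP; rewrite -subr_eq0 -scalerBl scaler_eq0 (negbTE u0').
  by rewrite orbF subr_eq0 => /eqP.
have lf : linear (f : X -> R^o).
  by move=> a x y; apply: inj; rewrite -fE linearP /= !fE scalerDl scalerA.
pose L : {linear X -> R^o} :=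
  HB.pack (f : X -> R^o) (GRing.isLinear.Build _ _ _ _ _ lf).
have cf : continuous (f : X -> R^o).
  apply: (@bounded_linear_continuous _ _ _ L); apply/bounded_funP => r.
  exists (`|A0| * r / `|u|) => x xr.
  rewrite ler_pdivlMr ?normr_gt0// -normrZ -fE.
  by apply: (le_trans (ler_clin_norm _ _)); rewrite ler_wpM2l.
exists (mk_clin lf cf); split.
- by apply/clin_eqP => x; exact: fE.
- move=> x Kx; apply: (cone_leZl coneK Ku' u0); rewrite scale0r subr0 -fE.
  by apply: pA0; exists x.
- by apply/clin_eqP => x; apply: inj; rewrite -!fE.
- by apply: inj; rewrite -fE scale1r.
- move=> x Kx x0.
  have Kz : K° ((A ^+ p) x) by apply: strA; exists x.
  have [d d0 dz] := interior_dominates coneK u Kz.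
  apply: (lt_le_trans d0); apply: (cone_leZl coneK Ku' u0); rewrite -fE.
  have A0p : A0 ((A ^+ p) x) = A0 x.
    by rewrite clin_exprE; elim: (p) => //= n <-.
  by rewrite -A0p -[u in d *: u]A0u -linearZ; exact: positive_le.
Unshelve. all: by end_near. Qed.

End fixed_interior_vector.

(** * Convergence of the powers *)

Theorem theorem7 (R : realType) (X : completeNormedModType R) (K : set X)
  (coneK : cone K) (closedK : closed K) (normalK : normal_cone K)
  (intK : K° !=set0)
  (A : clin X X) (posA : positive_operator K A)
  (strA : exists2 p : nat, (0 < p)%N & strongly_positive K (A ^+ p))
  (cptA : exists2 k : nat, (0 < k)%N & compact_operator (A ^+ k))
  (bndA : has_ubound [set `|A ^+ n| | n in [set n : nat | (0 < n)%N]]) :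
  exists A0 : clin X X,
    [/\ (forall x : X, (A ^+ n) x @[n --> \oo] --> A0 x),
        (A0 <> 0 ->
         exists (u : X) (f0 : dual X),
           [/\ K° u /\ dual_cone K f0,
               [/\ A u = u, adjoint A f0 = f0, f0 u = 1
                 & forall x : X, K x -> x <> 0 -> 0 < f0 x],
               A0 = tensor f0 u,
               (forall f : dual X,
                  {weak*, (adjoint A ^+ n) f @[n --> \oo] --> adjoint A0 f})
             & simple_eigenvalue A 1 /\ simple_eigenvalue (adjoint A) 1])
      & `|A ^+ n - A0| @[n --> \oo] --> (0 : R) /\
        `|adjoint (A ^+ n) - adjoint A0| @[n --> \oo] --> (0 : R)].
Proof.
have [M bM] : exists M, forall n, `|A ^+ n| <= M.
  have [M0 bM0] := bndA; exists (Num.max M0 `|A ^+ 0|) => -[|n].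
    by rewrite le_max lexx orbT.
  by rewrite le_max bM0//; exists n.+1.
have [p _ strAp] := strA; have [k _ cptAk] := cptA.
have [e Ke] := intK.
(* Either the orbit of the interior vector e comes arbitrarily close to 0, or
   it stays at a positive distance from 0. *)
have [small|] := pselect
    (forall eta : R, 0 < eta -> exists n, `|(A ^+ n) e| < eta).
  have A0 : `|A ^+ n - 0| @[n --> \oo] --> (0 : R).
    under eq_cvg do rewrite subr0.
    exact: (power_vanish coneK normalK posA bM Ke).
  exists 0; split=> //; first exact: cvg_clin_norm.
  by split=> //; exact: cvg_adjoint_norm.
move=> /existsNP[c /not_implyP[c0 /forallNP large]].
have [n|u [Ku Au u0]] := fixed_vector coneK closedK posA bM strAp cptAk Ke c0.
  by rewrite leNgt; apply/negP; exact: large.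
have [A0 cA0] : exists A0 : clin X X, `|A ^+ n - A0| @[n --> \oo] --> (0 : R).
  apply: clin_cauchy_cvg => eps eps0.
  have [q [D [q0 q1 HD]]] :=
    power_cauchy coneK closedK normalK posA strAp cptAk Ku Au.
  have lim0 : geometric D q n @[n --> \oo] --> (0 : R).
    by apply: cvg_geometric; rewrite gtr0_norm.
  have /cvgrPdist_le/(_ _ eps0)[j _ Hj] := lim0.
  exists ((p + k) * j)%N => n l jn jl; apply: (le_trans (HD j n l jn jl)).
  have := Hj j (leqnn j).
  by rewrite /= sub0r normrN => /(le_trans (ler_norm _)).
have [f0 [A0E f0K Af0 f0u f0_gt0]] :=
  limit_tensor coneK closedK posA strAp Ku Au u0 cA0.
have A0x := cvg_clin_norm cA0.
have A0w (f : dual X) :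
    {weak*, (adjoint A ^+ n) f @[n --> \oo] --> adjoint A0 f}.
  apply/weak_star_cvgP => x.
  suff : ((adjoint A ^+ n) f) x @[n --> \oo] --> f (A0 x) by [].
  under eq_cvg do rewrite -adjoint_expr adjointE.
  by apply: (@cvg_comp _ _ _ (fun n => (A ^+ n) x) f);
    [exact: A0x|exact: clin_continuous].
exists A0; split => //; last by split=> //; exact: cvg_adjoint_norm.
move=> _; exists u, f0; split => //; split.
  exists u; first exact/eqP.
  apply/seteqP; split => [v|_ [a _ <-]]; rewrite /op_eigenspace /= scale1r.
    move=> Av; exists (f0 v) => //.
    rewrite -[_ *: _]/(tensor f0 u v) -A0E.
    apply: (cvg_unique _ (A0x v)) => //=.
    rewrite (_ : (fun n => _) = fun n => v); first exact: cvg_cst.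
    by apply/funext => n; exact: expr_fixed.
  by rewrite linearZ /= Au.
exists f0.
  apply/eqP => f00; have := f0u; rewrite f00 => /eqP.
  by rewrite eq_sym oner_eq0.
apply/seteqP; split => [f|_ [a _ <-]]; rewrite /op_eigenspace /= scale1r.
  move=> Af; exists (f u) => //.
  apply/clin_eqP => x.
  have : f ((A ^+ n) x) @[n --> \oo] --> f (A0 x).
    by apply: (@cvg_comp _ _ _ (fun n => (A ^+ n) x) f);
      [exact: A0x|exact: clin_continuous].
  rewrite (_ : (fun n => _) = fun n => f x); last first.
    by apply/funext => n; rewrite -adjointE adjoint_expr expr_fixed.
  move=> /(cvg_unique _ (cvg_cst _)) ->//.
  by rewrite A0E /= linearZ; exact: mulrC.
by rewrite -[in RHS]Af0; apply/clin_eqP.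
Qed.
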